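(* (a) Let $0<\varepsilon\le 1$. If a quantum strategy for Hardy's game $H$ using a shared state in $\mathbb{C}^{d_A}\otimes\mathbb{C}^{d_B}$ succeeds with probability at least $1-\varepsilon$, then $\min(d_A,d_B)\ge \frac{1}{16\sqrt{\varepsilon}}$. In particular, no finite-dimensional quantum strategy wins $H$ with probability $1$. (b) Let $G$ be a two-player game with two questions per player ($\{A,A'\}$ for Alice, $\{B,B'\}$ for Bob), finite answer sets, and $\omega(G)<\omega^*(G)$, and assume $\pi_{\min}:=\min_{X,Y}\pi(X,Y)>0$. Let $0<\delta<\omega^*(G)-\omega(G)$ and let $G^\delta_\infty$ be as in the context. Then there is a constant $c>0$ depending only on $\pi_{\min}$ such that for every $\varepsilon>0$, every quantum strategy for $G^\delta_\infty$ using a shared state in $\mathbb{C}^{d_A}\otimes\mathbb{C}^{d_B}$ and succeeding with probability at least $1-\varepsilon$ satisfies $\min(d_A,d_B)\ge c/\sqrt{\varepsilon}$.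
   Context: A two-player nonlocal game $G=(V,\pi)$ has question sets, a distribution $\pi$ on question pairs, answer sets, and a verification function $V(a,b|x,y)\in\{0,1\}$. A quantum strategy consists of a finite-dimensional state $|\psi\rangle\in\mathbb{C}^{d_A}\otimes\mathbb{C}^{d_B}$ and POVMs $\{A^x_a\}_a$, $\{B^y_b\}_b$ for each question; its success probability is $\sum_{x,y}\pi(x,y)\sum_{a,b}V(a,b|x,y)\langle\psi|A^x_a\otimes B^y_b|\psi\rangle$. $\omega(G)$ (classical value) is the supremum of $\sum_{x,y}\pi(x,y)V(\alpha(x),\beta(y)|x,y)$ over deterministic answer functions $\alpha,\beta$; $\omega^*(G)$ (entangled value) is the supremum of success probabilities of finite-dimensional quantum strategies. Construction of $G^\delta_\infty$: fix a finite-dimensional quantum strategy $\mathcal{S}$ for $G$ with success probability at least $\omega^*(G)-\delta/2$, and let $\omega^{\mathcal{S}}_{XY}$ be its success probability conditioned on questions $(X,Y)$. In $G^\delta_\infty$ the questions and their distribution are those of $G$; answers are finite strings $a\in\mathcal{O}_A^*$, $b\in\mathcal{O}_B^*$; $V^\delta_\infty(a,b|X,Y)=1$ iff $|a|=|b|$ and the fraction of positions $i$ with $V(a_i,b_i|X,Y)=1$ is at least $\omega^{\mathcal{S}}_{XY}-\delta/2$. Hardy's game $H$: questions $\{A,A'\}$ and $\{B,B'\}$, each pair with probability $1/4$, answers in $\{0,1\}^*$, and $V(a,b|X,Y)=1$ iff $|a|=|b|=n$, if $(X,Y)=(A,B)$ then $a_i=b_i=0$ for some $i\in\{1,\dots,n\}$,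 and for every $i$: if $(X,Y)\in\{(A,B'),(A',B)\}$ then $a_i=1$ or $b_i=1$, and if $(X,Y)=(A',B')$ then $a_i=0$ or $b_i=0$. *)

(* Defs.v *)
From Stdlib Require Import Reals Lra List Bool Arith.
Open Scope R_scope.

Record C := mkC { Cre : R; Cim : R }.
Definition C0 : C := mkC 0 0.
Definition Cadd (z w : C) : C := mkC (Cre z + Cre w) (Cim z + Cim w).
Definition Cmul (z w : C) : C :=
  mkC (Cre z * Cre w - Cim z * Cim w) (Cre z * Cim w + Cim z * Cre w).
Definition Cconj (z : C) : C := mkC (Cre z) (- Cim z).

Fixpoint csum (n : nat) (f : nat -> C) : C :=
  match n with O => C0 | S k => Cadd (csum k f) (f k) end.

(** Matrices / vectors on C^d : only indices < d are relevant. *)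
Definition mat := nat -> nat -> C.
Definition vec := nat -> C.

Definition qform (d : nat) (M : mat) (v : vec) : C :=
  csum d (fun i => csum d (fun j => Cmul (Cmul (Cconj (v i)) (M i j)) (v j))).
Definition sqnorm (d : nat) (v : vec) : R :=
  Cre (csum d (fun i => Cmul (Cconj (v i)) (v i))).

Definition hermitian (d : nat) (M : mat) : Prop :=
  forall i j, (i < d)%nat -> (j < d)%nat -> M i j = Cconj (M j i).
Definition psd (d : nat) (M : mat) : Prop :=
  hermitian d M /\ forall v : vec, 0 <= Cre (qform d M v).

Definition nonneg_sum {I : Type} (f : I -> R) (s : R) : Prop :=
  (forall i, 0 <= f i) /\
  (forall l : list I, NoDup l -> fold_right Rplus 0 (map f l) <= s) /\
  (forall eta, 0 < eta -> exists l : list I,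
       NoDup l /\ s - eta <= fold_right Rplus 0 (map f l)).

(** POVM on C^d with outcomes in O: PSD elements with sum_a M a = I
    (the (possibly infinite) sum taken in the weak sense, which in finite
    dimension is equivalent to norm convergence). *)
Definition povm {O : Type} (d : nat) (M : O -> mat) : Prop :=
  (forall a, psd d (M a)) /\
  (forall v : vec, nonneg_sum (fun a => Cre (qform d (M a) v)) (sqnorm d v)).

(** * Two-player games with two questions per player.
    Questions: [false] = A (resp. B), [true] = A' (resp. B'). *)
Definition sum_q (f : bool -> bool -> R) : R :=
  f false false + f false true + f true false + f true true.

Definition is_distribution (pi : bool -> bool -> R) : Prop :=
  (forall x y, 0 <= pi x y) /\ sum_q pi = 1.

Definition pmin (pi : bool -> bool -> R) : R :=
  Rmin (Rmin (pi false false) (pi false true)) (Rmin (pi true false) (pi true true)).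

(** Quantum strategy: state psi in C^dA (x) C^dB given by its coefficient
    matrix psi i j (i < dA, j < dB); POVMs PA x, PB y. *)
Record strategy (OA OB : Type) := mkStrategy {
  dA : nat; dB : nat; psi : mat;
  PA : bool -> OA -> mat; PB : bool -> OB -> mat }.
Arguments dA {OA OB}. Arguments dB {OA OB}. Arguments psi {OA OB}.
Arguments PA {OA OB}. Arguments PB {OA OB}.

Definition valid_strategy {OA OB : Type} (S : strategy OA OB) : Prop :=
  Cre (csum (dA S) (fun i => csum (dB S) (fun j =>
          Cmul (Cconj (psi S i j)) (psi S i j)))) = 1 /\
  (forall x, povm (dA S) (PA S x)) /\ (forall y, povm (dB S) (PB S y)).

Definition corr (da db : nat) (ps : mat) (A B : mat) : R :=
  Cre (csum da (fun i => csum db (fun j => csum da (fun k => csum db (fun l =>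
    Cmul (Cmul (Cconj (ps i j)) (Cmul (A i k) (B j l))) (ps k l)))))).

Definition cond_success {OA OB : Type} (V : OA -> OB -> bool -> bool -> bool)
  (S : strategy OA OB) (x y : bool) (q : R) : Prop :=
  nonneg_sum (fun ab : OA * OB =>
    if V (fst ab) (snd ab) x y
    then corr (dA S) (dB S) (psi S) (PA S x (fst ab)) (PB S y (snd ab))
    else 0) q.

Definition success {OA OB : Type} (pi : bool -> bool -> R)
  (V : OA -> OB -> bool -> bool -> bool) (S : strategy OA OB) (p : R) : Prop :=
  valid_strategy S /\
  exists s : bool -> bool -> R,
    (forall x y, cond_success V S x y (s x y)) /\
    p = sum_q (fun x y => pi x y * s x y).

Definition classical_value {OA OB : Type} (pi : bool -> bool -> R)
  (V : OA -> OB -> bool -> bool -> bool) (w : R) : Prop :=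
  is_lub (fun p => exists (al : bool -> OA) (be : bool -> OB),
            p = sum_q (fun x y => pi x y * (if V (al x) (be y) x y then 1 else 0))) w.

Definition entangled_value {OA OB : Type} (pi : bool -> bool -> R)
  (V : OA -> OB -> bool -> bool -> bool) (w : R) : Prop :=
  is_lub (fun p => exists S : strategy OA OB, success pi V S p) w.

(** * Hardy's game (answers: false = 0, true = 1) *)
Definition hardy_pi (x y : bool) : R := 1 / 4.
Definition hardy_V (a b : list bool) (x y : bool) : bool :=
  Nat.eqb (length a) (length b) &&
  match x, y with
  | false, false => existsb (fun p => negb (fst p) && negb (snd p)) (combine a b)
  | false, true | true, false => forallb (fun p => fst p || snd p) (combine a b)
  | true, true => forallb (fun p => negb (fst p) || negb (snd p)) (combine a b)
  end.

(** * The game G^delta_infinity built from G = (pi, V) and the conditional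
    success probabilities s of a fixed strategy for G. *)
Definition count_wins {OA OB : Type} (V : OA -> OB -> bool -> bool -> bool)
  (x y : bool) (a : list OA) (b : list OB) : nat :=
  length (filter (fun p => V (fst p) (snd p) x y) (combine a b)).

Definition inf_V {OA OB : Type} (V : OA -> OB -> bool -> bool -> bool)
  (s : bool -> bool -> R) (delta : R) (a : list OA) (b : list OB) (x y : bool) : bool :=
  Nat.eqb (length a) (length b) && Nat.ltb 0 (length a) &&
  (if Rle_dec ((s x y - delta / 2) * INR (length a)) (INR (count_wins V x y a b))
   then true else false).

(* Main.v *)
(** Both games are unwinnable by a single quadruple of deterministic answers, and this
    alone forces the dimension bound.  Write K for the coefficient matrix of the state
    and split the measurements into rank-one effects, with amplitudes m(a,b).  Summed
    over all quadruples of outcomes, m(a,b) m(a',b)^* m(a',b') m(a,b')^* gives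
    tr((K K^* )^2), which is at least 1/d.  Every quadruple contains a losing pair e, so
    by AM-GM each term is at most (t |m_e|^2 |m_opp|^2 + |m_2|^2 |m_3|^2 / t) / 2, where
    opp is the pair of outcomes opposite to e in the 4-cycle and 2, 3 are the other two
    pairs; summing, 1/d is at most half of t * (total losing probability) + 4/t.
    Optimizing t gives d >= sqrt(pi_min) / (2 sqrt(eps)).  Infinite POVMs are truncated
    to finitely many outcomes plus one outcome that always loses. *)

Require Import Defs.
From Stdlib Require Import Reals List Lra Lia Bool Arith.
From Stdlib Require Import ClassicalEpsilon.
Import ListNotations.
Open Scope R_scope.

(** * Complex arithmetic: the ring structure, conjugation and the squared modulus *)

Local Notation C := Defs.C.
Infix "+c" := Cadd (at level 50, left associativity).
Infix "*c" := Cmul (at level 40, left associativity).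
Definition C1 : C := mkC 1 0.
Definition Copp (z : C) : C := mkC (- Cre z) (- Cim z).
Definition RtoC (x : R) : C := mkC x 0.
Definition Cnorm2 (z : C) : R := Cre z * Cre z + Cim z * Cim z.

Lemma C_eq (z w : C) : Cre z = Cre w -> Cim z = Cim w -> z = w.
Proof. destruct z, w; simpl; intros; subst; reflexivity. Qed.

Ltac Ceq := intros; apply C_eq; simpl; ring.

Lemma C_ring_theory :
  ring_theory C0 C1 Cadd Cmul (fun z w => z +c Copp w) Copp eq.
Proof. constructor; Ceq. Qed.
Add Ring C_ring : C_ring_theory.

Lemma Cconj_add z w : Cconj (z +c w) = Cconj z +c Cconj w.
Proof. Ceq. Qed.
Lemma Cconj_mul z w : Cconj (z *c w) = Cconj z *c Cconj w.
Proof. Ceq. Qed.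
Lemma Cconj_opp z : Cconj (Copp z) = Copp (Cconj z).
Proof. Ceq. Qed.
Lemma Cconj_conj z : Cconj (Cconj z) = z.
Proof. Ceq. Qed.
Lemma Cconj_0 : Cconj C0 = C0.
Proof. Ceq. Qed.
Lemma Cconj_RtoC x : Cconj (RtoC x) = RtoC x.
Proof. Ceq. Qed.
Lemma Cmul_conj z : z *c Cconj z = RtoC (Cnorm2 z).
Proof. unfold Cnorm2; Ceq. Qed.
Lemma Cnorm2_mul z w : Cnorm2 (z *c w) = Cnorm2 z * Cnorm2 w.
Proof. unfold Cnorm2; simpl; ring. Qed.
Lemma Cnorm2_ge0 z : 0 <= Cnorm2 z.
Proof. unfold Cnorm2; nra. Qed.
Lemma Cnorm2_eq0 z : Cnorm2 z = 0 -> z = C0.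
Proof. unfold Cnorm2; intros H; apply C_eq; simpl; nra. Qed.

(** Weighted AM-GM, from [(t a - b)^2 / t >= 0] applied to the real and the imaginary parts
    separately. The weight [t] stays free until the final optimization. *)
Lemma Cre_mul_conj_le t z w :
  0 < t -> Cre (z *c Cconj w) <= / 2 * (t * Cnorm2 z + / t * Cnorm2 w).
Proof.
  intros Ht; unfold Cnorm2; simpl.
  assert (E : forall a b, a * b <= / 2 * (t * (a * a) + / t * (b * b))).
  { intros a b.
    assert (0 <= / t * ((t * a - b) * (t * a - b))).
    { apply Rmult_le_pos; [left; now apply Rinv_0_lt_compat | apply Rle_0_sqr]. }
    replace (/ t * ((t * a - b) * (t * a - b)))
      with (t * (a * a) + / t * (b * b) - 2 * (a * b)) in H by (field; lra).
    lra. }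
  pose proof (E (Cre z) (Cre w)); pose proof (E (Cim z) (Cim w)); lra.
Qed.

(** Used to choose lists, frames and Gram vectors for all questions or outcomes at once. *)
Lemma functional_choice {A B : Type} (P : A -> B -> Prop) :
  (forall a, exists b, P a b) -> exists f : A -> B, forall a, P a (f a).
Proof.
  intros H; exists (fun a => proj1_sig (constructive_indefinite_description _ (H a))).
  intros a; exact (proj2_sig (constructive_indefinite_description _ (H a))).
Qed.

(** * Sums over lists *)

Definition RS {I : Type} (l : list I) (f : I -> R) : R := fold_right Rplus 0 (map f l).
Definition CS {I : Type} (l : list I) (f : I -> C) : C := fold_right Cadd C0 (map f l).

Lemma RS_cons {I} (a : I) l f : RS (a :: l) f = f a + RS l f.
Proof. reflexivity. Qed.
Lemma CS_cons {I} (a : I) l f : CS (a :: l) f = f a +c CS l f.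
Proof. reflexivity. Qed.

Lemma RS_app {I} (l l' : list I) f : RS (l ++ l') f = RS l f + RS l' f.
Proof. induction l; simpl; rewrite ?RS_cons, ?IHl; unfold RS; simpl; ring. Qed.
Lemma CS_app {I} (l l' : list I) f : CS (l ++ l') f = CS l f +c CS l' f.
Proof.
  induction l; simpl; rewrite ?CS_cons, ?IHl; [unfold CS at 2; simpl|]; ring.
Qed.
Lemma RS_map {I J} (h : I -> J) l f : RS (map h l) f = RS l (fun a => f (h a)).
Proof. unfold RS; now rewrite map_map. Qed.
Lemma CS_map {I J} (h : I -> J) l f : CS (map h l) f = CS l (fun a => f (h a)).
Proof. unfold CS; now rewrite map_map. Qed.

Lemma RS_ext {I} (l : list I) f g : (forall a, In a l -> f a = g a) -> RS l f = RS l g.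
Proof. intros H; unfold RS; f_equal; now apply map_ext_in. Qed.
Lemma CS_ext {I} (l : list I) f g : (forall a, In a l -> f a = g a) -> CS l f = CS l g.
Proof. intros H; unfold CS; f_equal; now apply map_ext_in. Qed.
Lemma RS_le {I} (l : list I) f g : (forall a, In a l -> f a <= g a) -> RS l f <= RS l g.
Proof.
  induction l; intros H; [unfold RS; simpl; lra|]; rewrite !RS_cons.
  apply Rplus_le_compat; [apply H | apply IHl; intros; apply H]; simpl; auto.
Qed.
Lemma RS_0 {I} (l : list I) : RS l (fun _ => 0) = 0.
Proof. induction l; [reflexivity|]; rewrite RS_cons, IHl; ring. Qed.
Lemma CS_0 {I} (l : list I) : CS l (fun _ => C0) = C0.
Proof. induction l; [reflexivity|]; rewrite CS_cons, IHl; ring. Qed.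
Lemma RS_ge0 {I} (l : list I) f : (forall a, In a l -> 0 <= f a) -> 0 <= RS l f.
Proof. intros H; rewrite <- (RS_0 l); now apply RS_le. Qed.
Lemma RS_add {I} (l : list I) f g : RS l (fun a => f a + g a) = RS l f + RS l g.
Proof. induction l; [unfold RS; simpl; ring|]; rewrite !RS_cons, IHl; ring. Qed.
Lemma CS_add {I} (l : list I) f g : CS l (fun a => f a +c g a) = CS l f +c CS l g.
Proof. induction l; [unfold CS; simpl; ring|]; rewrite !CS_cons, IHl; ring. Qed.
Lemma RS_mull {I} (l : list I) z f : RS l (fun a => z * f a) = z * RS l f.
Proof. induction l; [unfold RS; simpl; ring|]; rewrite !RS_cons, IHl; ring. Qed.
Lemma CS_mull {I} (l : list I) z f : CS l (fun a => z *c f a) = z *c CS l f.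
Proof. induction l; [unfold CS; simpl; ring|]; rewrite !CS_cons, IHl; ring. Qed.
Lemma RS_mulr {I} (l : list I) z f : RS l (fun a => f a * z) = RS l f * z.
Proof. induction l; [unfold RS; simpl; ring|]; rewrite !RS_cons, IHl; ring. Qed.
Lemma CS_mulr {I} (l : list I) z f : CS l (fun a => f a *c z) = CS l f *c z.
Proof. induction l; [unfold CS; simpl; ring|]; rewrite !CS_cons, IHl; ring. Qed.
Lemma RS_swap {I J} (l : list I) (l' : list J) f :
  RS l (fun a => RS l' (fun b => f a b)) = RS l' (fun b => RS l (fun a => f a b)).
Proof.
  induction l; [symmetry; exact (RS_0 l')|].
  rewrite RS_cons, IHl, <- RS_add; reflexivity.
Qed.
Lemma CS_swap {I J} (l : list I) (l' : list J) f :
  CS l (fun a => CS l' (fun b => f a b)) = CS l' (fun b => CS l (fun a => f a b)).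
Proof.
  induction l; [symmetry; exact (CS_0 l')|].
  rewrite CS_cons, IHl, <- CS_add; reflexivity.
Qed.
Lemma RS_prod {I J} (l : list I) (l' : list J) f :
  RS (list_prod l l') f = RS l (fun a => RS l' (fun b => f (a, b))).
Proof.
  induction l; [reflexivity|]; simpl; rewrite RS_app, RS_map, IHl; reflexivity.
Qed.
Lemma CS_prod {I J} (l : list I) (l' : list J) f :
  CS (list_prod l l') f = CS l (fun a => CS l' (fun b => f (a, b))).
Proof.
  induction l; [reflexivity|]; simpl; rewrite CS_app, CS_map, IHl; reflexivity.
Qed.
Lemma Cconj_CS {I} (l : list I) f : Cconj (CS l f) = CS l (fun a => Cconj (f a)).
Proof.
  induction l; [apply Cconj_0|]; rewrite !CS_cons, Cconj_add, IHl; reflexivity.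
Qed.
Lemma Cre_CS {I} (l : list I) f : Cre (CS l f) = RS l (fun a => Cre (f a)).
Proof. induction l; [reflexivity|]; rewrite CS_cons, RS_cons, <- IHl; reflexivity. Qed.
Lemma CS_RtoC {I} (l : list I) f : CS l (fun a => RtoC (f a)) = RtoC (RS l f).
Proof. induction l; [reflexivity|]; rewrite CS_cons, RS_cons, IHl; Ceq. Qed.

Lemma RS_term_le {I} (l : list I) f a :
  (forall b, In b l -> 0 <= f b) -> In a l -> f a <= RS l f.
Proof.
  induction l as [|b l IH]; intros H Ha; [destruct Ha|]; rewrite RS_cons.
  assert (Hl : forall b, In b l -> 0 <= f b) by (intros; apply H; simpl; auto).
  destruct Ha as [->|Ha].
  - pose proof (RS_ge0 l f Hl); lra.
  - pose proof (IH Hl Ha); pose proof (H b (or_introl eq_refl)); lra.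
Qed.

(** Each head of [l] is removed from [l'] once; since [l] has no duplicates, its tail still lies in
    what remains. *)
Lemma RS_incl_le {I} (l l' : list I) f :
  NoDup l -> incl l l' -> (forall a, 0 <= f a) -> RS l f <= RS l' f.
Proof.
  intros Hl; revert l'; induction Hl as [|a l Ha Hl IH]; intros l' Hi Hf.
  - now apply RS_ge0.
  - destruct (in_split a l' (Hi a (or_introl eq_refl))) as [l1 [l2 ->]].
    assert (Hi' : incl l (l1 ++ l2)).
    { intros b Hb. pose proof (Hi b (or_intror Hb)) as Hb'.
      apply in_app_or in Hb'; apply in_or_app.
      destruct Hb' as [|[<-|]]; auto. contradiction. }
    pose proof (IH _ Hi' Hf) as E.
    rewrite RS_app in *; rewrite !RS_cons; lra.
Qed.

(** Cauchy-Schwarz against the constant function 1; in the induction the cross terms are bounded by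
    [2 x y <= x^2 + y^2]. *)
Lemma RS_sqr_le {I} (l : list I) f :
  RS l f * RS l f <= INR (length l) * RS l (fun a => f a * f a).
Proof.
  induction l as [|a l IH]; [unfold RS; simpl; lra|].
  rewrite !RS_cons; cbn [length]; rewrite S_INR.
  assert (E : 2 * (f a * RS l f) <= RS l (fun b => f a * f a + f b * f b)).
  { rewrite <- !RS_mull; apply RS_le; intros b _.
    pose proof (Rle_0_sqr (f a - f b)); unfold Rsqr in *; lra. }
  rewrite RS_add in E.
  replace (RS l (fun _ => f a * f a)) with (INR (length l) * (f a * f a)) in E.
  - lra.
  - clear; induction l as [|b l IH]; [unfold RS; simpl; ring|].
    rewrite RS_cons; cbn [length]; rewrite S_INR, <- IH; ring.
Qed.

Lemma csum_CS n f : csum n f = CS (seq 0 n) f.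
Proof.
  induction n; [reflexivity|].
  rewrite seq_S, CS_app, <- IHn; simpl; unfold CS; simpl; ring.
Qed.

Lemma in_seq0 n i : In i (seq 0 n) <-> (i < n)%nat.
Proof. rewrite in_seq; lia. Qed.

Lemma CS_seq_S n f : CS (seq 0 (S n)) f = CS (seq 0 n) f +c f n.
Proof. now rewrite <- !csum_CS. Qed.

(** * Positive semidefinite matrices as Gram matrices *)

Lemma qform_CS d M v :
  qform d M v
  = CS (seq 0 d) (fun i => CS (seq 0 d) (fun j => Cconj (v i) *c M i j *c v j)).
Proof.
  unfold qform; rewrite csum_CS; apply CS_ext; intros; now rewrite csum_CS.
Qed.

Lemma qform_ext d M M' v v' :
  (forall i j, (i < d)%nat -> (j < d)%nat -> M i j = M' i j) ->
  (forall i, (i < d)%nat -> v i = v' i) -> qform d M v = qform d M' v'.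
Proof.
  intros HM Hv; rewrite !qform_CS; apply CS_ext; intros i Hi; apply CS_ext; intros j Hj.
  apply in_seq0 in Hi; apply in_seq0 in Hj; now rewrite HM, !Hv.
Qed.

Lemma qform_S d M v :
  qform (S d) M v
  = qform d M v +c CS (seq 0 d) (fun i => Cconj (v i) *c M i d) *c v d
    +c Cconj (v d) *c CS (seq 0 d) (fun j => M d j *c v j)
    +c Cconj (v d) *c M d d *c v d.
Proof.
  rewrite !qform_CS, CS_seq_S, <- !CS_mull, <- !CS_mulr.
  rewrite (CS_ext (seq 0 d)
     (fun i => CS (seq 0 (S d)) (fun j => Cconj (v i) *c M i j *c v j))
     (fun i => CS (seq 0 d) (fun j => Cconj (v i) *c M i j *c v j)
               +c Cconj (v i) *c M i d *c v d))
    by (intros; now rewrite CS_seq_S).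
  rewrite CS_add, CS_seq_S.
  rewrite (CS_ext _ (fun j => Cconj (v d) *c M d j *c v j)
             (fun j => Cconj (v d) *c (M d j *c v j))) by (intros; ring).
  ring.
Qed.

(* Cholesky factorization, eliminating the last index first. *)
Lemma psd_gram d M :
  psd d M ->
  exists w : nat -> vec, forall i j, (i < d)%nat -> (j < d)%nat ->
    M i j = CS (seq 0 d) (fun k => w k i *c Cconj (w k j)).
Proof.
  revert M; induction d as [|d IH]; intros M [HM HP].
  { exists (fun _ _ => C0); intros; lia. }
  set (ext := fun (v : vec) (z : C) => fun i => if (i <? d)%nat then v i else z).
  assert (Eq : forall v z, qform (S d) M (ext v z)
     = qform d M v +c CS (seq 0 d) (fun i => Cconj (v i) *c M i d) *c z
       +c Cconj z *c CS (seq 0 d) (fun j => M d j *c v j) +c Cconj z *c M d d *c z).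
  { intros v z; rewrite qform_S.
    assert (Ev : forall i, (i < d)%nat -> ext v z i = v i).
    { intros i Hi; unfold ext; now rewrite (proj2 (Nat.ltb_lt i d) Hi). }
    assert (Ez : ext v z d = z) by (unfold ext; now rewrite Nat.ltb_irrefl).
    rewrite Ez, (qform_ext d M M (ext v z) v) by auto.
    rewrite (CS_ext _ (fun i => Cconj (ext v z i) *c M i d) (fun i => Cconj (v i) *c M i d)),
      (CS_ext _ (fun j => M d j *c ext v z j) (fun j => M d j *c v j)); auto;
      intros i Hi; apply in_seq0 in Hi; now rewrite Ev. }
  assert (HPe : forall v z, 0 <= Cre (qform (S d) M (ext v z))) by (intros; apply HP).
  assert (Hd : M d d = RtoC (Cre (M d d))).
  { pose proof (HM d d (Nat.lt_succ_diag_r d) (Nat.lt_succ_diag_r d)) as H.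
    apply C_eq; [reflexivity|]; apply (f_equal Cim) in H; simpl in *; lra. }
  set (m := Cre (M d d)) in *.
  assert (Hcol : forall i, (i < d)%nat -> M d i = Cconj (M i d)) by (intros; apply HM; lia).
  assert (Hconjsum : forall v, CS (seq 0 d) (fun j => M d j *c v j)
             = Cconj (CS (seq 0 d) (fun i => Cconj (v i) *c M i d))).
  { intros v; rewrite Cconj_CS; apply CS_ext; intros i Hi; apply in_seq0 in Hi.
    rewrite Cconj_mul, Cconj_conj, Hcol by auto; ring. }
  assert (Hm : 0 <= m).
  { pose proof (HPe (fun _ => C0) C1) as H; rewrite Eq in H.
    rewrite qform_CS, Hd in H.
    rewrite (CS_ext _ _ (fun _ => C0)) in H
      by (intros; rewrite (CS_ext _ _ (fun _ => C0)) by (intros; ring); apply CS_0).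
    rewrite (CS_ext _ (fun j => M d j *c C0) (fun _ => C0)) in H by (intros; ring).
    rewrite (CS_ext _ (fun j => _ *c M j d) (fun _ => C0)) in H
      by (intros; rewrite Cconj_0; ring).
    rewrite CS_0 in H; simpl in H; lra. }
  (* Positive pivot: a rank-one matrix built from the last column is subtracted, leaving the Schur
     complement [M']. Zero pivot: positivity makes the last column vanish, and the leading block is
     factored alone. *)
  destruct Hm as [Hm|Hm].
  - set (r := fun i => M i d *c RtoC (/ sqrt m)).
    assert (Hs : 0 < sqrt m) by now apply sqrt_lt_R0.
    assert (Hss : sqrt m * sqrt m = m) by (apply sqrt_sqrt; lra).
    set (M' := fun i j => M i j +c Copp (r i *c Cconj (r j))).
    destruct (IH M') as [w Hw].
    { split.
      - intros i j Hi Hj; unfold M'.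
        rewrite Cconj_add, Cconj_opp, Cconj_mul, Cconj_conj, <- HM by lia; ring.
      - intros v.
        set (s := CS (seq 0 d) (fun i => Cconj (v i) *c M i d)).
        (* This last coordinate completes the square: it minimizes the form over [z], and the
           minimum is the form of the Schur complement at [v]. *)
        pose proof (HPe v (Copp (RtoC (/ m) *c Cconj s))) as H.
        rewrite Eq, Hconjsum in H; fold s in H; rewrite Hd in H.
        assert (EM : qform d M' v = qform d M v +c Copp (RtoC (/ m) *c (s *c Cconj s))).
        { rewrite !qform_CS; unfold M'.
          rewrite (CS_ext _ _ (fun i => CS (seq 0 d) (fun j => Cconj (v i) *c M i j *c v j)
             +c (Copp (RtoC (/ m)) *c (Cconj (v i) *c M i d)) *c
                CS (seq 0 d) (fun j => Cconj (Cconj (v j) *c M j d)))).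
          - rewrite CS_add, CS_mulr, CS_mull, <- Cconj_CS; fold s; ring.
          - intros i Hi. rewrite <- CS_mull, <- CS_add; apply CS_ext; intros j Hj.
            unfold r; rewrite !Cconj_mul, Cconj_conj, Cconj_RtoC.
            replace (RtoC (/ m)) with (RtoC (/ sqrt m) *c RtoC (/ sqrt m)); [ring|].
            replace (/ m) with (/ sqrt m * / sqrt m)
              by (rewrite <- Rinv_mult; now rewrite Hss).
            Ceq. }
        rewrite EM, Cmul_conj.
        rewrite Cconj_opp, Cconj_mul, Cconj_RtoC, Cconj_conj in H.
        unfold Cnorm2; simpl in *.
        assert (Em : / m * m = 1) by (field; lra).
        set (im := / m) in *.
        (* Both [m] and [im] occur in [H]; once everything is expressed in [im], [H] and the goal
           differ by a field identity. *)
        replace m with (/ im) in H by (unfold im; field; lra).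
        assert (im <> 0) by (intros E; rewrite E in Em; lra).
        match type of H with _ <= ?x => match goal with |- _ <= ?y =>
          replace y with x; [exact H| field; assumption] end end. }
    (* The vectors of the induction hypothesis are unconstrained at coordinate [d], so they are set
       to 0 there; [r] becomes vector number [d] and alone produces the last row and column. *)
    exists (fun k i => if (k <? d)%nat then (if (i <? d)%nat then w k i else C0) else r i).
    assert (Edd : r d = RtoC (sqrt m)).
    { unfold r; rewrite Hd; apply C_eq; simpl; [|ring].
      rewrite <- Hss at 1; field; lra. }
    intros i j Hi Hj; rewrite CS_seq_S, Nat.ltb_irrefl.
    assert (Hz : (i = d \/ j = d) -> M i j = r i *c Cconj (r j)).
    { intros [->| ->].
      - rewrite Edd, HM by lia; unfold r; rewrite Cconj_mul, Cconj_RtoC.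
        replace (RtoC (sqrt m) *c (Cconj (M j d) *c RtoC (/ sqrt m)))
          with (Cconj (M j d) *c RtoC (sqrt m * / sqrt m)) by Ceq.
        rewrite Rinv_r by lra. Ceq.
      - rewrite Edd, Cconj_RtoC; unfold r.
        replace (M i d *c RtoC (/ sqrt m) *c RtoC (sqrt m))
          with (M i d *c RtoC (sqrt m * / sqrt m)) by Ceq.
        rewrite Rinv_r by lra. Ceq. }
    destruct (Nat.eq_dec i d) as [Ei|Ei]; [|destruct (Nat.eq_dec j d) as [Ej|Ej]].
    1,2: rewrite Hz by auto; rewrite (CS_ext _ _ (fun _ => C0)), CS_0; [ring|];
         intros k Hk; apply in_seq0 in Hk; rewrite (proj2 (Nat.ltb_lt k d) Hk); subst;
         rewrite Nat.ltb_irrefl, ?Cconj_0; ring.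
    rewrite (CS_ext _ _ (fun k => w k i *c Cconj (w k j))).
    + rewrite <- Hw by lia; unfold M'; ring.
    + intros k Hk; apply in_seq0 in Hk; rewrite (proj2 (Nat.ltb_lt k d) Hk).
      now rewrite !(proj2 (Nat.ltb_lt _ d)) by lia.
  - assert (Hc0 : forall i, (i < d)%nat -> M i d = C0).
    { set (u := fun i => M i d).
      set (N := RS (seq 0 d) (fun i => Cnorm2 (u i))).
      (* With [u] the last column, the test vector [(-x u, 1)] gives [0 <= x^2 q - 2 x N], where [q]
         is the form at [u]. A small [x] then forces [N <= 0]; for [q > 0] the choice [x = N / q]
         suffices. *)
      assert (HN : forall x, 0 < x -> 2 * N <= x * Cre (qform d M u)).
      { intros x Hx.
        pose proof (HPe (fun i => RtoC (- x) *c u i) C1) as H.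
        rewrite Eq, Hconjsum, Hd, <- Hm in H.
        rewrite (CS_ext _ _ (fun i => RtoC (- x) *c RtoC (Cnorm2 (u i)))) in H
          by (intros; unfold u; rewrite <- Cmul_conj, Cconj_mul, Cconj_RtoC; ring).
        rewrite CS_mull, CS_RtoC in H; fold N in H.
        replace (qform d M (fun i => RtoC (- x) *c u i))
          with (RtoC (x * x) *c qform d M u) in H.
        - simpl in H. nra.
        - rewrite !qform_CS, <- CS_mull; apply CS_ext; intros.
          rewrite <- CS_mull; apply CS_ext; intros.
          rewrite Cconj_mul, Cconj_RtoC.
          replace (RtoC (x * x)) with (RtoC (- x) *c RtoC (- x)) by Ceq. ring. }
      set (q := Cre (qform d M u)) in *.
      assert (Hn0 : N <= 0).
      { apply Rnot_lt_le; intros HN0.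
        destruct (Rle_or_lt q 0) as [Hq|Hq].
        - pose proof (HN 1 Rlt_0_1); nra.
        - assert (E : 0 < N / q) by now apply Rdiv_lt_0_compat.
          pose proof (HN (N / q) E) as E'.
          replace (N / q * q) with N in E' by (field; lra); lra. }
      intros i Hi; apply Cnorm2_eq0, Rle_antisym; [|apply Cnorm2_ge0].
      apply Rle_trans with N; [|exact Hn0].
      apply (RS_term_le (seq 0 d) (fun i => Cnorm2 (u i)));
        [intros; apply Cnorm2_ge0|now apply in_seq0]. }
    destruct (IH M) as [w Hw].
    { split; [intros i j Hi Hj; apply HM; lia|].
      intros v; pose proof (HPe v C0) as H; rewrite Eq in H.
      rewrite Cconj_0 in H; simpl in H; lra. }
    exists (fun k i => if (k <? d)%nat then (if (i <? d)%nat then w k i else C0) else C0).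
    intros i j Hi Hj; rewrite CS_seq_S, Nat.ltb_irrefl.
    destruct (Nat.eq_dec i d) as [Ei|Ei]; [|destruct (Nat.eq_dec j d) as [Ej|Ej]].
    1,2: assert (Z : M i j = C0) by
          (subst; (destruct (Nat.eq_dec i d) as [->|]; [|now apply Hc0; lia]) ||
           (destruct (Nat.eq_dec j d) as [->|]; [|rewrite Hcol, Hc0 by lia; apply Cconj_0]);
           rewrite Hd, <- Hm; reflexivity);
         rewrite Z, (CS_ext _ _ (fun _ => C0)), CS_0; [ring|];
         intros k Hk; apply in_seq0 in Hk; rewrite (proj2 (Nat.ltb_lt k d) Hk); subst;
         rewrite Nat.ltb_irrefl, ?Cconj_0; ring.
    rewrite (CS_ext _ _ (fun k => w k i *c Cconj (w k j))).
    + rewrite <- Hw by lia; ring.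
    + intros k Hk; apply in_seq0 in Hk; rewrite (proj2 (Nat.ltb_lt k d) Hk).
      now rewrite !(proj2 (Nat.ltb_lt _ d)) by lia.
Qed.

(** * Rank-one measurements *)

(** A Parseval frame, that is, a measurement with rank-one effects. The vectors need be neither
    orthogonal nor normalized. *)
Definition frame {T : Type} (d : nat) (l : list T) (w : T -> vec) : Prop :=
  forall i j, (i < d)%nat -> (j < d)%nat ->
    CS l (fun a => w a i *c Cconj (w a j)) = if Nat.eqb i j then C1 else C0.

Definition cdot (d : nat) (w f : vec) : C := CS (seq 0 d) (fun i => Cconj (w i) *c f i).

(** The inner product of the product vector [w (x) u] with the state whose coefficient matrix is
    [K]. *)
Definition amp (da db : nat) (K : mat) (w u : vec) : C :=
  cdot da w (fun i => cdot db u (K i)).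

(** Exchanges the players, so that a bound on Alice's dimension also serves for Bob's. *)
Lemma amp_transpose da db K w u : amp da db K w u = amp db da (fun j i => K i j) u w.
Proof.
  unfold amp, cdot.
  rewrite (CS_ext _ _ (fun i => CS (seq 0 db) (fun j => Cconj (w i) *c (Cconj (u j) *c K i j))))
    by (intros; now rewrite CS_mull).
  rewrite CS_swap; apply CS_ext; intros; rewrite <- CS_mull; apply CS_ext; intros; ring.
Qed.

Lemma CS_delta n j f :
  (j < n)%nat -> CS (seq 0 n) (fun i => (if Nat.eqb i j then C1 else C0) *c f i) = f j.
Proof.
  induction n; intros Hj; [lia|]; rewrite CS_seq_S.
  destruct (Nat.eq_dec n j) as [->|Hn].
  - rewrite Nat.eqb_refl, (CS_ext _ _ (fun _ => C0)), CS_0; [ring|].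
    intros i Hi; apply in_seq0 in Hi; rewrite (proj2 (Nat.eqb_neq i j)) by lia; ring.
  - rewrite IHn by lia; rewrite (proj2 (Nat.eqb_neq n j)) by lia; ring.
Qed.

(** Polarized Parseval identity: after expanding both inner products, the sum over the frame comes
    first and yields a Kronecker delta. *)
Lemma frame_parseval {T} d (l : list T) w f g :
  frame d l w ->
  CS l (fun a => cdot d (w a) f *c Cconj (cdot d (w a) g))
  = CS (seq 0 d) (fun i => f i *c Cconj (g i)).
Proof.
  intros Hw.
  rewrite (CS_ext l _ (fun a => CS (seq 0 d) (fun i => CS (seq 0 d) (fun j =>
      (w a j *c Cconj (w a i)) *c (f i *c Cconj (g j)))))).
  - rewrite CS_swap; apply CS_ext; intros i Hi; apply in_seq0 in Hi.
    rewrite CS_swap.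
    rewrite (CS_ext _ _ (fun j => (if Nat.eqb j i then C1 else C0) *c (f i *c Cconj (g j)))).
    + now apply CS_delta.
    + intros j Hj; apply in_seq0 in Hj; now rewrite CS_mulr, Hw.
  - intros a _; unfold cdot; rewrite Cconj_CS, <- CS_mulr; apply CS_ext; intros.
    rewrite <- CS_mull; apply CS_ext; intros; rewrite Cconj_mul, Cconj_conj; ring.
Qed.

Definition frob2 (da db : nat) (K : mat) : R :=
  RS (seq 0 da) (fun i => RS (seq 0 db) (fun j => Cnorm2 (K i j))).

Lemma frob2_transpose da db K : frob2 da db K = frob2 db da (fun j i => K i j).
Proof. apply RS_swap. Qed.

(** Normalization of the joint outcome distribution: Parseval on Alice's side, then on Bob's. *)
Lemma frame_frob2 {T U} da db K (lA : list T) wA (lB : list U) wB :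
  frame da lA wA -> frame db lB wB ->
  RS lA (fun a => RS lB (fun b => Cnorm2 (amp da db K (wA a) (wB b)))) = frob2 da db K.
Proof.
  intros HA HB.
  assert (E : CS lA (fun a => CS lB (fun b =>
      amp da db K (wA a) (wB b) *c Cconj (amp da db K (wA a) (wB b))))
    = CS (seq 0 da) (fun i => CS (seq 0 db) (fun j => K i j *c Cconj (K i j)))).
  { rewrite CS_swap.
    rewrite (CS_ext lB _ (fun b => CS (seq 0 da) (fun i =>
       cdot db (wB b) (K i) *c Cconj (cdot db (wB b) (K i)))))
      by (intros; now apply frame_parseval).
    rewrite CS_swap; apply CS_ext; intros; now apply frame_parseval. }
  apply (f_equal Cre) in E; rewrite !Cre_CS in E; unfold frob2.
  etransitivity; [|etransitivity; [exact E|]]; apply RS_ext; intros;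
    rewrite Cre_CS; apply RS_ext; intros; rewrite Cmul_conj; reflexivity.
Qed.

(* The right-hand side is tr((K K^* )^2), the purity of the reduced state. *)
Lemma purity_ge da db K :
  frob2 da db K = 1 ->
  / INR da <= RS (seq 0 da) (fun i => RS (seq 0 da) (fun j =>
      Cnorm2 (CS (seq 0 db) (fun k => K i k *c Cconj (K j k))))).
Proof.
  intros HK.
  set (rho := fun i j => CS (seq 0 db) (fun k => K i k *c Cconj (K j k))).
  assert (E : forall i, Cre (rho i i) = RS (seq 0 db) (fun k => Cnorm2 (K i k))).
  { intros; unfold rho; rewrite Cre_CS; apply RS_ext; intros; now rewrite Cmul_conj. }
  pose proof (RS_sqr_le (seq 0 da) (fun i => Cre (rho i i))) as H.
  rewrite (RS_ext _ (fun i => Cre (rho i i)) _ (fun i _ => E i)) in H at 1 2.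
  fold (frob2 da db K) in H; rewrite HK, length_seq in H.
  (* For [da = 0] the Cauchy-Schwarz inequality [H] would read [1 <= 0]. *)
  assert (Hd : 0 < INR da).
  { destruct da; [unfold RS in H; simpl in H; lra|]; apply lt_0_INR; lia. }
  (* The diagonal of [rho] suffices: it sums to 1, so its squares sum to at least [1 / da]. *)
  apply Rle_trans with (RS (seq 0 da) (fun i => Cre (rho i i) * Cre (rho i i))).
  - apply Rmult_le_reg_l with (INR da); [assumption|]; rewrite Rinv_r by lra; lra.
  - apply RS_le; intros i Hi.
    apply Rle_trans with (Cnorm2 (rho i i)); [unfold Cnorm2; nra|].
    apply (RS_term_le (seq 0 da) (fun j => Cnorm2 (rho i j))); auto.
    intros; apply Cnorm2_ge0.
Qed.

(** Parseval collapses one outcome sum at a time. The sums over [a] and [a'] give the two inner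
    products of Alice's vectors [kB b] and [kB' b']; in coordinates [i], [j] the sum over [b'] then
    gives the conjugate of [rho i j], and the sum over [b] gives [rho i j]. *)
Lemma frame_cycle {T U} da db K (lA lA' : list T) wA wA' (lB lB' : list U) wB wB' :
  frame da lA wA -> frame da lA' wA' -> frame db lB wB -> frame db lB' wB' ->
  Cre (CS lA (fun a => CS lA' (fun a' => CS lB (fun b => CS lB' (fun b' =>
    (amp da db K (wA a) (wB b) *c amp da db K (wA' a') (wB' b')) *c
    Cconj (amp da db K (wA' a') (wB b) *c amp da db K (wA a) (wB' b')))))))
  = RS (seq 0 da) (fun i => RS (seq 0 da) (fun j =>
      Cnorm2 (CS (seq 0 db) (fun k => K i k *c Cconj (K j k))))).
Proof.
  intros HA HA' HB HB'.
  set (kB := fun b i => cdot db (wB b) (K i)).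
  set (kB' := fun b i => cdot db (wB' b) (K i)).
  set (rho := fun i j => CS (seq 0 db) (fun k => K i k *c Cconj (K j k))).
  transitivity (Cre (CS (seq 0 da) (fun i => CS (seq 0 da) (fun j =>
     rho i j *c Cconj (rho i j))))).
  2:{ rewrite Cre_CS; apply RS_ext; intros; rewrite Cre_CS; apply RS_ext; intros.
      now rewrite Cmul_conj. }
  f_equal.
  transitivity (CS lB (fun b => CS lB' (fun b' =>
     CS lA (fun a => cdot da (wA a) (kB b) *c Cconj (cdot da (wA a) (kB' b'))) *c
     CS lA' (fun a => cdot da (wA' a) (kB' b') *c Cconj (cdot da (wA' a) (kB b)))))).
  { rewrite (CS_ext lA _ (fun a => CS lB (fun b => CS lB' (fun b' => CS lA' (fun a' =>
       (amp da db K (wA a) (wB b) *c amp da db K (wA' a') (wB' b')) *c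
       Cconj (amp da db K (wA' a') (wB b) *c amp da db K (wA a) (wB' b')))))))
      by (intros; rewrite CS_swap; apply CS_ext; intros; apply CS_swap).
    rewrite CS_swap; apply CS_ext; intros b _.
    rewrite CS_swap; apply CS_ext; intros b' _.
    rewrite <- CS_mulr; apply CS_ext; intros a _.
    rewrite <- CS_mull; apply CS_ext; intros a' _.
    rewrite Cconj_mul; unfold amp; fold (kB b) (kB' b'); ring. }
  rewrite (CS_ext lB _ (fun b => CS lB' (fun b' => CS (seq 0 da) (fun i => CS (seq 0 da) (fun j =>
     (kB b i *c Cconj (kB b j)) *c (kB' b' j *c Cconj (kB' b' i))))))).
  2:{ intros b _; apply CS_ext; intros b' _.
      rewrite !frame_parseval, <- CS_mulr by assumption; apply CS_ext; intros.
      rewrite <- CS_mull; apply CS_ext; intros; ring. }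
  rewrite (CS_ext lB _ (fun b => CS (seq 0 da) (fun i => CS (seq 0 da) (fun j =>
     (kB b i *c Cconj (kB b j)) *c Cconj (rho i j))))).
  2:{ intros b _; rewrite CS_swap; apply CS_ext; intros i _.
      rewrite CS_swap; apply CS_ext; intros j _; rewrite CS_mull; f_equal.
      unfold kB', rho; rewrite frame_parseval by assumption.
      rewrite Cconj_CS; apply CS_ext; intros; rewrite Cconj_mul, Cconj_conj; ring. }
  rewrite CS_swap; apply CS_ext; intros i _.
  rewrite CS_swap; apply CS_ext; intros j _.
  rewrite CS_mulr; f_equal; unfold kB; now rewrite frame_parseval.
Qed.

(** * The losing-pair inequality on the 4-cycle of outcomes *)

Definition lose (b : bool) : R := if b then 0 else 1.

(** AM-GM puts the weight [t] on the product that contains a losing pair. All cases are added up on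
    the right so that the bound has one form, whichever pair loses. AM-GM itself yields [/ t]; the
    factor 2 before it is slack. *)
Lemma four_cycle_term_le t (m00 m01 m10 m11 : C) (W00 W01 W10 W11 : bool) :
  0 < t -> ~ (W00 = true /\ W01 = true /\ W10 = true /\ W11 = true) ->
  Cre ((m00 *c m11) *c Cconj (m10 *c m01)) <=
  / 2 * (t * ((lose W00 * Cnorm2 m00) * Cnorm2 m11) + t * (Cnorm2 m00 * (lose W11 * Cnorm2 m11))
       + t * ((lose W10 * Cnorm2 m10) * Cnorm2 m01) + t * (Cnorm2 m10 * (lose W01 * Cnorm2 m01))
       + 2 * / t * (Cnorm2 m00 * Cnorm2 m11) + 2 * / t * (Cnorm2 m10 * Cnorm2 m01)).
Proof.
  intros Ht HW.
  pose proof (Cre_mul_conj_le t (m00 *c m11) (m10 *c m01) Ht) as H1.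
  pose proof (Cre_mul_conj_le t (m10 *c m01) (m00 *c m11) Ht) as H2.
  replace (Cre ((m10 *c m01) *c Cconj (m00 *c m11)))
    with (Cre ((m00 *c m11) *c Cconj (m10 *c m01))) in H2 by (simpl; ring).
  rewrite !Cnorm2_mul in H1, H2.
  assert (Hp : 0 <= Cnorm2 m00 * Cnorm2 m11) by (apply Rmult_le_pos; apply Cnorm2_ge0).
  assert (Hq : 0 <= Cnorm2 m10 * Cnorm2 m01) by (apply Rmult_le_pos; apply Cnorm2_ge0).
  assert (Hti : 0 < / t) by now apply Rinv_0_lt_compat.
  pose proof (Rmult_le_pos _ _ (Rlt_le _ _ Ht) Hp).
  pose proof (Rmult_le_pos _ _ (Rlt_le _ _ Ht) Hq).
  pose proof (Rmult_le_pos _ _ (Rlt_le _ _ Hti) Hp).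
  pose proof (Rmult_le_pos _ _ (Rlt_le _ _ Hti) Hq).
  destruct W00, W01, W10, W11; unfold lose; try lra; exfalso; tauto.
Qed.

(* In the expansion of tr((K K^* )^2) over quadruples of outcomes every term contains
   the amplitude of a losing pair, so AM-GM bounds it by the losing probabilities. *)
Lemma frame_game_bound {T U} da db K (lA : bool -> list T) (wA : bool -> T -> vec)
  (lB : bool -> list U) (wB : bool -> U -> vec) (W : bool -> bool -> T -> U -> bool) t :
  (forall x, frame da (lA x) (wA x)) -> (forall y, frame db (lB y) (wB y)) ->
  (forall a b, ~ (forall x y, W x y (a x) (b y) = true)) ->
  frob2 da db K = 1 -> 0 < t ->
  / INR da <= / 2 * (t * sum_q (fun x y => RS (lA x) (fun a => RS (lB y) (fun b =>
      lose (W x y a b) * Cnorm2 (amp da db K (wA x a) (wB y b))))) + 4 * / t).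
Proof.
  intros HA HB HW HK Ht.
  apply Rle_trans with (1 := purity_ge da db K HK).
  rewrite <- (frame_cycle da db K (lA false) (lA true) (wA false) (wA true)
                (lB false) (lB true) (wB false) (wB true)) by auto.
  set (n := fun x y a b => Cnorm2 (amp da db K (wA x a) (wB y b))).
  set (f := fun x y a b => lose (W x y a b) * n x y a b).
  set (Q := fun F : T -> T -> U -> U -> R => RS (lA false) (fun a => RS (lA true) (fun a' =>
     RS (lB false) (fun b => RS (lB true) (fun b' => F a a' b b'))))).
  assert (Qadd : forall F G, Q (fun a a' b b' => F a a' b b' + G a a' b b') = Q F + Q G).
  { intros F G; unfold Q; rewrite <- RS_add; apply RS_ext; intros.
    rewrite <- RS_add; apply RS_ext; intros; rewrite <- RS_add; apply RS_ext; intros.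
    apply RS_add. }
  assert (Qmul : forall z F, Q (fun a a' b b' => z * F a a' b b') = z * Q F).
  { intros z F; unfold Q; rewrite <- RS_mull; apply RS_ext; intros.
    rewrite <- RS_mull; apply RS_ext; intros; rewrite <- RS_mull; apply RS_ext; intros.
    apply RS_mull. }
  set (S := fun (F : bool -> bool -> T -> U -> R) x y =>
         RS (lA x) (fun a => RS (lB y) (fun b => F x y a b))).
  (* Opposite pairs of the 4-cycle share no outcome, so sums of products over quadruples factor;
     [Qo] treats the other opposite pairs. *)
  assert (Qd : forall F G, Q (fun a a' b b' => F false false a b * G true true a' b')
                           = S F false false * S G true true).
  { intros F G; unfold Q, S; rewrite <- RS_mulr; apply RS_ext; intros a _.
    rewrite <- RS_mull; apply RS_ext; intros a' _.
    rewrite <- RS_mulr; apply RS_ext; intros b _.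
    now rewrite RS_mull. }
  assert (Qo : forall F G, Q (fun a a' b b' => F true false a' b * G false true a b')
                           = S F true false * S G false true).
  { intros F G; unfold Q, S; rewrite Rmult_comm, <- RS_mulr; apply RS_ext; intros a _.
    rewrite <- RS_mull; apply RS_ext; intros a' _.
    rewrite Rmult_comm, <- RS_mulr; apply RS_ext; intros b _.
    now rewrite RS_mull. }
  assert (Sn : forall x y, S n x y = 1).
  { intros x y; unfold S, n; rewrite frame_frob2; auto. }
  rewrite Cre_CS.
  apply Rle_trans with (Q (fun a a' b b' =>
    / 2 * (t * (f false false a b * n true true a' b')
         + t * (n false false a b * f true true a' b')
         + t * (f true false a' b * n false true a b')
         + t * (n true false a' b * f false true a b')
         + 2 * / t * (n false false a b * n true true a' b')
         + 2 * / t * (n true false a' b * n false true a b')))).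
  - apply RS_le; intros a _; rewrite Cre_CS; apply RS_le; intros a' _.
    rewrite Cre_CS; apply RS_le; intros b _; rewrite Cre_CS; apply RS_le; intros b' _.
    apply four_cycle_term_le; [assumption|].
    intros [H00 [H01 [H10 H11]]].
    (* A quadruple of outcomes is a deterministic strategy, so it cannot win on all four pairs. *)
    apply (HW (fun x => if x then a' else a) (fun y => if y then b' else b)).
    intros [] []; assumption.
  - rewrite Qmul, !Qadd, !Qmul, !Qd, !Qo, !Sn.
    change (/ 2 * (t * (S f false false * 1) + t * (1 * S f true true)
      + t * (S f true false * 1) + t * (1 * S f false true) + 2 * / t * (1 * 1) + 2 * / t * (1 * 1))
      <= / 2 * (t * (S f false false + S f false true + S f true false + S f true true) + 4 * / t)).
    lra.
Qed.

(** * From strategies to frames *)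

(** Positivity is exactly the bound on finite partial sums contained in [nonneg_sum]. *)
Lemma psd_identity_minus d {O : Type} (M : O -> mat) (L : list O) :
  povm d M -> NoDup L ->
  psd d (fun i j => (if Nat.eqb i j then C1 else C0) +c Copp (CS L (fun a => M a i j))).
Proof.
  intros [HM HS] HL; split.
  - intros i j Hi Hj; rewrite Cconj_add, Cconj_opp, Cconj_CS, Nat.eqb_sym.
    f_equal; [destruct (Nat.eqb j i); Ceq|f_equal; apply CS_ext; intros; now apply HM].
  - intros v.
    assert (E : qform d (fun i j => (if Nat.eqb i j then C1 else C0)
                    +c Copp (CS L (fun a => M a i j))) v
       = CS (seq 0 d) (fun i => Cconj (v i) *c v i) +c Copp (CS L (fun a => qform d (M a) v))).
    { rewrite (CS_ext L _ _ (fun a _ => qform_CS d (M a) v)).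
      rewrite CS_swap, qform_CS.
      replace (Copp (CS (seq 0 d) (fun i => CS L (fun a => CS (seq 0 d) (fun j =>
                  Cconj (v i) *c M a i j *c v j)))))
        with (CS (seq 0 d) (fun i => Copp C1 *c CS L (fun a => CS (seq 0 d) (fun j =>
                  Cconj (v i) *c M a i j *c v j)))) by (rewrite CS_mull; ring).
      rewrite <- CS_add; apply CS_ext; intros i Hi; apply in_seq0 in Hi.
      rewrite CS_swap, <- CS_mull.
      rewrite <- (CS_delta d i (fun j => Cconj (v i) *c v j)), <- CS_add by assumption.
      apply CS_ext; intros j Hj; rewrite CS_mulr, CS_mull, Nat.eqb_sym; ring. }
    rewrite E.
    change (0 <= Cre (CS (seq 0 d) (fun i => Cconj (v i) *c v i))
                 + - Cre (CS L (fun a => qform d (M a) v))).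
    rewrite (Cre_CS L).
    destruct (HS v) as [_ [H _]]; specialize (H L HL).
    unfold sqnorm in H; rewrite csum_CS in H; unfold RS; lra.
Qed.

(** The effects listed in [L], together with their complement to the identity under [None], form a
    finite measurement; a Gram factorization splits each effect into [d] rank-one pieces, indexed by
    the second component. *)
Lemma povm_frame {O : Type} d (M : O -> mat) (L : list O) :
  povm d M -> NoDup L ->
  exists w : option O * nat -> vec,
    frame d (list_prod (None :: map Some L) (seq 0 d)) w /\
    forall a i j, (i < d)%nat -> (j < d)%nat ->
      M a i j = CS (seq 0 d) (fun k => w (Some a, k) i *c Cconj (w (Some a, k) j)).
Proof.
  intros HM HL.
  set (N := fun o : option O => match o with
    | Some a => M a
    | None => fun i j => (if Nat.eqb i j then C1 else C0) +c Copp (CS L (fun a => M a i j)) end).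
  assert (HN : forall o, exists w : nat -> vec, forall i j, (i < d)%nat -> (j < d)%nat ->
    N o i j = CS (seq 0 d) (fun k => w k i *c Cconj (w k j))).
  { intros [a|]; apply psd_gram; [apply HM|now apply psd_identity_minus]. }
  destruct (functional_choice _ HN) as [w Hw].
  exists (fun p => w (fst p) (snd p)); split.
  - intros i j Hi Hj; rewrite CS_prod; simpl.
    rewrite (CS_ext _ _ (fun o => N o i j)) by (intros; symmetry; now apply Hw).
    rewrite CS_cons, CS_map; simpl; ring.
  - intros a; exact (Hw (Some a)).
Qed.

(** The Born probability of a pair of effects is the sum over their rank-one pieces. Contracting [B]
    and then [A] with the state leaves [amp]; the remaining sum against the conjugate state rebuilds
    its conjugate. *)
Lemma corr_amp da db K A B w u :
  (forall i j, (i < da)%nat -> (j < da)%nat ->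
     A i j = CS (seq 0 da) (fun k => w k i *c Cconj (w k j))) ->
  (forall i j, (i < db)%nat -> (j < db)%nat ->
     B i j = CS (seq 0 db) (fun k => u k i *c Cconj (u k j))) ->
  corr da db K A B
  = RS (seq 0 da) (fun p => RS (seq 0 db) (fun q => Cnorm2 (amp da db K (w p) (u q)))).
Proof.
  intros HA HB.
  assert (EB : forall j k, (j < db)%nat -> CS (seq 0 db) (fun l => B j l *c K k l)
     = CS (seq 0 db) (fun q => u q j *c cdot db (u q) (K k))).
  { intros j k Hj; unfold cdot.
    rewrite (CS_ext _ _ (fun l => CS (seq 0 db) (fun q => u q j *c (Cconj (u q l) *c K k l)))).
    - rewrite CS_swap; apply CS_ext; intros; apply CS_mull.
    - intros l Hl; apply in_seq0 in Hl; rewrite HB, <- CS_mulr by assumption.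
      apply CS_ext; intros; ring. }
  assert (EA : forall i f, (i < da)%nat -> CS (seq 0 da) (fun k => A i k *c f k)
     = CS (seq 0 da) (fun p => w p i *c cdot da (w p) f)).
  { intros i f Hi; unfold cdot.
    rewrite (CS_ext _ _ (fun k => CS (seq 0 da) (fun p => w p i *c (Cconj (w p k) *c f k)))).
    - rewrite CS_swap; apply CS_ext; intros; apply CS_mull.
    - intros l Hl; apply in_seq0 in Hl; rewrite HA, <- CS_mulr by assumption.
      apply CS_ext; intros; ring. }
  transitivity (Cre (CS (seq 0 da) (fun p => CS (seq 0 db) (fun q =>
    amp da db K (w p) (u q) *c Cconj (amp da db K (w p) (u q)))))).
  2:{ rewrite Cre_CS; apply RS_ext; intros; rewrite Cre_CS; apply RS_ext; intros.
      now rewrite Cmul_conj. }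
  unfold corr; f_equal.
  transitivity (CS (seq 0 da) (fun i => CS (seq 0 db) (fun j =>
    Cconj (K i j) *c CS (seq 0 db) (fun q => u q j *c
       CS (seq 0 da) (fun p => w p i *c amp da db K (w p) (u q)))))).
  { rewrite csum_CS; apply CS_ext; intros i Hi; apply in_seq0 in Hi.
    rewrite csum_CS; apply CS_ext; intros j Hj; apply in_seq0 in Hj.
    rewrite csum_CS, <- CS_mull.
    rewrite (CS_ext _ _ (fun k => Cconj (K i j) *c (A i k *c CS (seq 0 db) (fun l => B j l *c K k l)))).
    - rewrite CS_mull, CS_mull; f_equal.
      rewrite (CS_ext (seq 0 da) _ (fun k => CS (seq 0 db) (fun q =>
         u q j *c (A i k *c cdot db (u q) (K k))))).
      + rewrite CS_swap; apply CS_ext; intros q _; rewrite CS_mull; f_equal.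
        now rewrite (EA i (fun k => cdot db (u q) (K k))).
      + intros k _; rewrite EB, <- CS_mull by assumption; apply CS_ext; intros; ring.
    - intros k _; rewrite csum_CS, <- !CS_mull; apply CS_ext; intros; ring. }
  rewrite (CS_ext _ _ (fun i => CS (seq 0 da) (fun p => CS (seq 0 db) (fun q =>
    amp da db K (w p) (u q) *c (w p i *c CS (seq 0 db) (fun j => u q j *c Cconj (K i j))))))).
  - rewrite CS_swap; apply CS_ext; intros p _.
    rewrite CS_swap; apply CS_ext; intros q _; rewrite CS_mull; f_equal.
    unfold amp, cdot; rewrite Cconj_CS; apply CS_ext; intros i _.
    rewrite Cconj_mul, Cconj_conj, Cconj_CS; f_equal; apply CS_ext; intros j _.
    now rewrite Cconj_mul, Cconj_conj.
  - intros i _; rewrite CS_swap.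
    rewrite (CS_ext _ _ (fun j => CS (seq 0 db) (fun q => CS (seq 0 da) (fun p =>
      amp da db K (w p) (u q) *c w p i *c (u q j *c Cconj (K i j)))))).
    + rewrite CS_swap; apply CS_ext; intros q _; rewrite CS_swap; apply CS_ext; intros p _.
      rewrite CS_mull; ring.
    + intros j _; rewrite <- CS_mull; apply CS_ext; intros q _.
      rewrite <- !CS_mull; apply CS_ext; intros; ring.
Qed.

(* [None] is the extra outcome completing a finite part of a POVM; it always loses. *)
Definition option_win {OA OB : Type} (V : OA -> OB -> bool -> bool -> bool) (x y : bool)
  (a : option OA * nat) (b : option OB * nat) : bool :=
  match fst a, fst b with Some a, Some b => V a b x y | _, _ => false end.

Definition unwinnable {OA OB : Type} (V : OA -> OB -> bool -> bool -> bool) : Prop :=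
  forall (al : bool -> OA) (be : bool -> OB), ~ (forall x y, V (al x) (be y) x y = true).

(** Winning on the two pairs of equal questions already forces all four outcomes to be genuine
    answers. *)
Lemma option_unwinnable {OA OB : Type} (V : OA -> OB -> bool -> bool -> bool) al be :
  unwinnable V -> ~ (forall x y, option_win V x y (al x) (be y) = true).
Proof.
  unfold option_win; intros HV H.
  pose proof (H true true) as H1; pose proof (H false false) as H2.
  destruct (fst (al true)) as [a1|] eqn:Ea1; [|discriminate].
  destruct (fst (al false)) as [a0|] eqn:Ea0; [|discriminate].
  destruct (fst (be true)) as [b1|] eqn:Eb1; [|discriminate].
  destruct (fst (be false)) as [b0|] eqn:Eb0; [|discriminate].
  apply (HV (fun x => if x then a1 else a0) (fun y => if y then b1 else b0)).
  intros x y; specialize (H x y); destruct x, y;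
    rewrite ?Ea1, ?Ea0, ?Eb1, ?Eb0 in H; exact H.
Qed.

(** The answer type is arbitrary, so equality is decided classically. *)
Lemma nodup_cover {O : Type} (l : list O) : exists L, NoDup L /\ incl l L.
Proof.
  exists (nodup (fun a b => excluded_middle_informative (a = b)) l); split.
  - apply NoDup_nodup.
  - intros a Ha; now apply nodup_In.
Qed.

(** Finitely many answer pairs carry each winning probability up to [eta]. The outcomes of the
    completed measurements have total probability 1, so losing has probability at most
    [1 - s x y + eta]. *)
Lemma strategy_frames {OA OB : Type} (V : OA -> OB -> bool -> bool -> bool)
  (S : strategy OA OB) (s : bool -> bool -> R) eta :
  valid_strategy S -> (forall x y, cond_success V S x y (s x y)) -> 0 < eta ->
  exists (lA : list (option OA * nat)) (lB : list (option OB * nat)) wA wB,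
    (forall x, frame (dA S) lA (wA x)) /\ (forall y, frame (dB S) lB (wB y)) /\
    forall x y, RS lA (fun a => RS lB (fun b => lose (option_win V x y a b) *
        Cnorm2 (amp (dA S) (dB S) (psi S) (wA x a) (wB y b)))) <= 1 - s x y + eta.
Proof.
  intros [HS1 [HA HB]] Hs Heta.
  assert (Hl : forall x y, exists l : list (OA * OB), NoDup l /\
     s x y - eta <= RS l (fun ab => if V (fst ab) (snd ab) x y
       then corr (dA S) (dB S) (psi S) (PA S x (fst ab)) (PB S y (snd ab)) else 0)).
  { intros x y; destruct (Hs x y) as [_ [_ H]]; exact (H eta Heta). }
  destruct (functional_choice _ (fun x => functional_choice _ (Hl x))) as [l El].
  (* Pooling the four lists gives each player one outcome list, common to both questions. *)
  set (ls := l false false ++ l false true ++ l true false ++ l true true).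
  assert (Hls : forall x y, incl (l x y) ls).
  { intros [] [] ab Hab; unfold ls; rewrite !in_app_iff; auto. }
  destruct (nodup_cover (map fst ls)) as [LA [NA IA]].
  destruct (nodup_cover (map snd ls)) as [LB [NB IB]].
  destruct (functional_choice _ (fun x => povm_frame (dA S) (PA S x) LA (HA x) NA)) as [wA EA].
  destruct (functional_choice _ (fun y => povm_frame (dB S) (PB S y) LB (HB y) NB)) as [wB EB].
  exists (list_prod (None :: map Some LA) (seq 0 (dA S))),
    (list_prod (None :: map Some LB) (seq 0 (dB S))), wA, wB.
  split; [intros; apply EA|split; [intros; apply EB|]].
  intros x y.
  set (lA := list_prod (None :: map Some LA) (seq 0 (dA S))) in *.
  set (lB := list_prod (None :: map Some LB) (seq 0 (dB S))) in *.
  set (n := fun a b => Cnorm2 (amp (dA S) (dB S) (psi S) (wA x a) (wB y b))).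
  assert (Hn : forall a b, 0 <= n a b) by (intros; apply Cnorm2_ge0).
  assert (Hsum : RS lA (fun a => RS lB (fun b => n a b)) = 1).
  { unfold n; rewrite frame_frob2 by (apply EA || apply EB).
    rewrite csum_CS, Cre_CS in HS1; rewrite <- HS1; apply RS_ext; intros.
    rewrite csum_CS, Cre_CS; apply RS_ext; intros; unfold Cnorm2; simpl; ring. }
  set (g := fun a b => if option_win V x y a b then n a b else 0).
  assert (Hg : forall a b, 0 <= g a b)
    by (intros; unfold g; destruct option_win; [apply Hn|lra]).
  assert (Hsplit : RS lA (fun a => RS lB (fun b => lose (option_win V x y a b) * n a b))
    + RS lA (fun a => RS lB (fun b => g a b)) = 1).
  { rewrite <- Hsum, <- RS_add; apply RS_ext; intros; rewrite <- RS_add; apply RS_ext; intros.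
    unfold g, lose; destruct option_win; ring. }
  assert (Hwin : s x y - eta <= RS lA (fun a => RS lB (fun b => g a b))).
  { destruct (El x y) as [Hnd Hle]; apply Rle_trans with (1 := Hle).
    (* Enlarging to the full product list only adds terms, which are nonnegative by
       [cond_success]. *)
    apply Rle_trans with (RS (list_prod LA LB) (fun ab => if V (fst ab) (snd ab) x y
       then corr (dA S) (dB S) (psi S) (PA S x (fst ab)) (PB S y (snd ab)) else 0)).
    { apply RS_incl_le; [assumption| |apply (Hs x y)].
      intros [a b] Hab; apply Hls in Hab; apply in_prod.
      - apply IA, (in_map fst _ _ Hab).
      - apply IB, (in_map snd _ _ Hab). }
    rewrite RS_prod; simpl.
    apply Rle_trans with (RS LA (fun a => RS (seq 0 (dA S)) (fun k =>
        RS LB (fun b => RS (seq 0 (dB S)) (fun k' => g (Some a, k) (Some b, k')))))).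
    - right; apply RS_ext; intros a _; rewrite RS_swap; apply RS_ext; intros b _.
      unfold g, option_win; simpl; destruct (V a b x y).
      + rewrite (corr_amp _ _ _ _ _ (fun k => wA x (Some a, k)) (fun k => wB y (Some b, k)));
          [reflexivity|apply EA|apply EB].
      + rewrite (RS_ext _ _ (fun _ => 0)); [now rewrite RS_0|intros; apply RS_0].
    (* The blocks belonging to [None] are split off on each side and dropped as nonnegative. *)
    - unfold lA, lB; rewrite RS_prod, RS_cons, RS_map.
      match goal with |- ?u <= ?z + ?v => cut (0 <= z /\ u <= v); [lra|split] end.
      + apply RS_ge0; intros; apply RS_ge0; intros; apply Hg.
      + apply RS_le; intros a _; apply RS_le; intros k _.
        rewrite RS_prod, RS_cons, RS_map.
        match goal with |- ?u <= ?z + ?v => cut (0 <= z /\ u <= v); [lra|split; [|lra]] end.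
        apply RS_ge0; intros; apply Hg. }
  change (RS lA (fun a => RS lB (fun b => lose (option_win V x y a b) * n a b))
          <= 1 - s x y + eta).
  lra.
Qed.

(** * Dimension bounds for unwinnable games *)

Lemma unwinnable_dim_bound {OA OB : Type} (V : OA -> OB -> bool -> bool -> bool)
  (S : strategy OA OB) (s : bool -> bool -> R) t :
  unwinnable V -> valid_strategy S -> (forall x y, cond_success V S x y (s x y)) -> 0 < t ->
  / INR (Nat.min (dA S) (dB S)) <= / 2 * (t * sum_q (fun x y => 1 - s x y) + 4 * / t).
Proof.
  intros HV HS Hs Ht; apply le_epsilon; intros e He.
  (* Four question pairs, each with this error, contribute [/ 2 * t * 4 * (e / (2 * t)) = e]. *)
  assert (Heta : 0 < e / (2 * t)) by (apply Rdiv_lt_0_compat; lra).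
  destruct (strategy_frames V S s _ HS Hs Heta) as [lA [lB [wA [wB [HA [HB Hlose]]]]]].
  assert (HK : frob2 (dA S) (dB S) (psi S) = 1).
  { destruct HS as [HS _]; rewrite csum_CS, Cre_CS in HS; rewrite <- HS; apply RS_ext; intros.
    rewrite csum_CS, Cre_CS; apply RS_ext; intros; unfold Cnorm2; simpl; ring. }
  set (f := fun x y => RS lA (fun a => RS lB (fun b => lose (option_win V x y a b) *
        Cnorm2 (amp (dA S) (dB S) (psi S) (wA x a) (wB y b))))) in Hlose.
  assert (Hf : t * sum_q f <= t * sum_q (fun x y => 1 - s x y) + 2 * e).
  { assert (sum_q f <= sum_q (fun x y => 1 - s x y) + 4 * (e / (2 * t))).
    { pose proof (Hlose false false); pose proof (Hlose false true);
      pose proof (Hlose true false); pose proof (Hlose true true); unfold sum_q, f; lra. }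
    replace (2 * e) with (t * (4 * (e / (2 * t)))) by (field; lra); nra. }
  assert (Hfin : / INR (Nat.min (dA S) (dB S)) <= / 2 * (t * sum_q f + 4 * / t)).
  { destruct (Nat.min_dec (dA S) (dB S)) as [->| ->].
    - apply (frame_game_bound (dA S) (dB S) (psi S) (fun _ => lA) wA (fun _ => lB) wB (option_win V) t);
        auto; intros; now apply option_unwinnable.
    - replace (sum_q f) with (sum_q (fun y x => RS lB (fun b => RS lA (fun a =>
        lose (option_win V x y a b) *
        Cnorm2 (amp (dB S) (dA S) (fun j i => psi S i j) (wB y b) (wA x a)))))).
      + apply (frame_game_bound (dB S) (dA S) (fun j i => psi S i j) (fun _ => lB) wB
          (fun _ => lA) wA (fun y x b a => option_win V x y a b) t); auto.
        * intros b a H; apply (option_unwinnable V a b HV); intros x y; apply H.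
        * now rewrite <- frob2_transpose.
      + assert (E : forall x y, RS lB (fun b => RS lA (fun a => lose (option_win V x y a b) *
           Cnorm2 (amp (dB S) (dA S) (fun j i => psi S i j) (wB y b) (wA x a)))) = f x y).
        { intros x y; unfold f; rewrite RS_swap; apply RS_ext; intros; apply RS_ext; intros.
          now rewrite <- amp_transpose. }
        unfold sum_q; rewrite !E; ring. }
  lra.
Qed.

(** Every question pair has weight at least [pmin pi], so the unweighted total losing probability is
    at most [eps / pmin pi]; then [t] is optimized. *)
Lemma success_dim_bound {OA OB : Type} pi (V : OA -> OB -> bool -> bool -> bool)
  (S : strategy OA OB) p eps :
  unwinnable V -> is_distribution pi -> 0 < pmin pi ->
  success pi V S p -> 0 < eps -> 1 - eps <= p ->
  (sqrt (pmin pi) / 2) / sqrt eps <= INR (Nat.min (dA S) (dB S)).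
Proof.
  intros HV [_ Hpi] Hpm [HS [s [Hs ->]]] Heps Hp.
  set (q := sqrt (pmin pi)); set (r := sqrt eps).
  assert (Hq : 0 < q) by now apply sqrt_lt_R0.
  assert (Hr : 0 < r) by now apply sqrt_lt_R0.
  assert (Hqq : q * q = pmin pi) by (apply sqrt_sqrt; lra).
  assert (Hrr : r * r = eps) by (apply sqrt_sqrt; lra).
  assert (Hmin : forall x y, pmin pi <= pi x y).
  { intros x y; unfold pmin.
    set (m1 := Rmin (pi false false) (pi false true)).
    set (m2 := Rmin (pi true false) (pi true true)).
    pose proof (Rmin_l m1 m2); pose proof (Rmin_r m1 m2).
    assert (m1 <= pi false false /\ m1 <= pi false true)
      by (split; [apply Rmin_l|apply Rmin_r]).
    assert (m2 <= pi true false /\ m2 <= pi true true)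
      by (split; [apply Rmin_l|apply Rmin_r]).
    destruct x, y; lra. }
  (* The losing probability of the truncated measurements is nonnegative and at most [1 - s x y + e]
     for every [e > 0]. *)
  assert (Hs1 : forall x y, s x y <= 1).
  { intros x y; apply le_epsilon; intros e He.
    destruct (strategy_frames V S s e HS Hs He) as [lA [lB [wA [wB [_ [_ H]]]]]].
    specialize (H x y).
    match type of H with ?u <= _ => assert (0 <= u) end; [|lra].
    apply RS_ge0; intros; apply RS_ge0; intros; apply Rmult_le_pos; [|apply Cnorm2_ge0].
    unfold lose; destruct option_win; lra. }
  set (F := sum_q (fun x y => 1 - s x y)).
  assert (HF : q * q * F <= r * r).
  { rewrite Hqq, Hrr; apply Rle_trans with (sum_q (fun x y => pi x y * (1 - s x y))).
    - unfold F, sum_q.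
      assert (E : forall x y, pmin pi * (1 - s x y) <= pi x y * (1 - s x y)).
      { intros; apply Rmult_le_compat_r; [specialize (Hs1 x y); lra|apply Hmin]. }
      pose proof (E false false); pose proof (E false true);
      pose proof (E true false); pose proof (E true true); lra.
    - unfold sum_q in *; lra. }
  (* [t = 2 q / r] minimizes [t * (r / q)^2 + 4 / t] *)
  assert (Ht : 0 < 2 * q / r) by (apply Rdiv_lt_0_compat; lra).
  pose proof (unwinnable_dim_bound V S s _ HV HS Hs Ht) as H; fold F in H.
  assert (H' : / INR (Nat.min (dA S) (dB S)) <= 2 * r / q).
  { apply Rle_trans with (1 := H).
    apply Rle_trans with (/ 2 * (2 / (q * r) * (r * r) + 4 * / (2 * q / r))).
    - apply Rmult_le_compat_l; [lra|]; apply Rplus_le_compat_r.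
      replace (2 * q / r * F) with (2 / (q * r) * (q * q * F)) by (field; lra).
      apply Rmult_le_compat_l; [|assumption].
      left; apply Rdiv_lt_0_compat; [lra|nra].
    - right; field; lra. }
  (* A zero dimension would make the norm of the state an empty sum, hence 0. Positivity is needed
     to invert the inequality. *)
  assert (HD : 0 < INR (Nat.min (dA S) (dB S))).
  { apply lt_0_INR; destruct HS as [HS _].
    destruct (dA S); [simpl in HS; lra|]; destruct (dB S); [|lia].
    exfalso; rewrite csum_CS, (CS_ext _ _ (fun _ => C0)), CS_0 in HS by reflexivity.
    simpl in HS; lra. }
  replace (q / 2 / r) with (/ (2 * r / q)) by (field; lra).
  rewrite <- (Rinv_inv (INR _)); apply Rinv_le_contravar; [|assumption].
  now apply Rinv_0_lt_compat.
Qed.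

(** * The two games *)

(** At a position where the answers to [A] and [B] are both 0, the mixed pairs force the answers to
    [A'] and [B'] to be 1, which loses on the last pair. The induction looks for this position along
    the four strings; empty strings already lose on [(A, B)]. *)
Lemma hardy_unwinnable : unwinnable hardy_V.
Proof.
  intros al be H.
  pose proof (H false false) as H00; pose proof (H false true) as H01;
  pose proof (H true false) as H10; pose proof (H true true) as H11.
  unfold hardy_V in *; clear H.
  revert H00 H01 H10 H11.
  generalize (al false) as a, (al true) as a', (be false) as b, (be true) as b'.
  clear; induction a as [|[] a IH]; intros [|[] a'] [|[] b] [|[] b']; simpl;
    rewrite ?andb_true_l, ?andb_false_r; try discriminate; intros; eapply IH; eassumption.
Qed.

Lemma count_wins_cons {OA OB : Type} (V : OA -> OB -> bool -> bool -> bool) x y a b la lb :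
  INR (count_wins V x y (a :: la) (b :: lb))
  = (if V a b x y then 1 else 0) + INR (count_wins V x y la lb).
Proof.
  unfold count_wins; simpl; destruct (V a b x y); cbn [length]; rewrite ?S_INR; ring.
Qed.

(** The letters at a fixed position form a deterministic strategy for the base game, of value at
    most [w]; these bounds add up over the [n] positions. *)
Lemma count_wins_classical {OA OB : Type} pi (V : OA -> OB -> bool -> bool -> bool) w
  (al : bool -> list OA) (be : bool -> list OB) n :
  classical_value pi V w ->
  (forall x, length (al x) = n) -> (forall y, length (be y) = n) ->
  sum_q (fun x y => pi x y * INR (count_wins V x y (al x) (be y))) <= w * INR n.
Proof.
  intros [Hw _]; revert al be; induction n as [|n IH]; intros al be Ha Hb.
  - assert (E : forall x y, INR (count_wins V x y (al x) (be y)) = 0).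
    { intros x y; specialize (Ha x); destruct (al x); [reflexivity|discriminate]. }
    unfold sum_q; rewrite !E; simpl; lra.
  - assert (Da : forall x, exists p, al x = fst p :: snd p /\ length (snd p) = n).
    { intros x; specialize (Ha x); destruct (al x) as [|a l]; [discriminate|].
      exists (a, l); simpl in *; auto. }
    assert (Db : forall y, exists p, be y = fst p :: snd p /\ length (snd p) = n).
    { intros y; specialize (Hb y); destruct (be y) as [|b l]; [discriminate|].
      exists (b, l); simpl in *; auto. }
    destruct (functional_choice _ Da) as [ha Ea].
    destruct (functional_choice _ Db) as [hb Eb].
    specialize (IH (fun x => snd (ha x)) (fun y => snd (hb y))
      (fun x => proj2 (Ea x)) (fun y => proj2 (Eb y))).
    assert (H1 := Hw _ (ex_intro _ (fun x => fst (ha x)) (ex_intro _ (fun y => fst (hb y)) eq_refl))).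
    assert (E : forall x y, INR (count_wins V x y (al x) (be y))
      = (if V (fst (ha x)) (fst (hb y)) x y then 1 else 0)
        + INR (count_wins V x y (snd (ha x)) (snd (hb y)))).
    { intros x y; rewrite (proj1 (Ea x)), (proj1 (Eb y)) at 1; apply count_wins_cons. }
    unfold sum_q in *; rewrite !E, S_INR; lra.
Qed.

(** Four winning strings of common length [n] would have an average count of at least
    [(wstar - delta) * n]: one [delta / 2] comes from the strategy, the other from the threshold.
    This exceeds the classical bound [w * n], strictly because [inf_V] demands [n > 0]. *)
Lemma inf_V_unwinnable {OA OB : Type} pi (V : OA -> OB -> bool -> bool -> bool) w wstar delta s :
  is_distribution pi -> classical_value pi V w -> delta < wstar - w ->
  wstar - delta / 2 <= sum_q (fun x y => pi x y * s x y) ->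
  unwinnable (inf_V V s delta).
Proof.
  intros [Hpi0 Hpi1] Hw Hd Hs al be H.
  assert (H' : forall x y, length (al x) = length (be y) /\ (0 < length (al x))%nat /\
    (s x y - delta / 2) * INR (length (al x)) <= INR (count_wins V x y (al x) (be y))).
  { intros x y; specialize (H x y); unfold inf_V in H.
    apply andb_prop in H; destruct H as [H H3]; apply andb_prop in H; destruct H as [H1 H2].
    apply Nat.eqb_eq in H1; apply Nat.ltb_lt in H2; split; [|split]; auto.
    destruct Rle_dec; [assumption|discriminate]. }
  set (n := length (al false)).
  assert (Hbe : forall y, length (be y) = n) by (intros y; symmetry; apply H').
  assert (Hal : forall x, length (al x) = n)
    by (intros x; rewrite (proj1 (H' x false)); apply Hbe).
  pose proof (count_wins_classical pi V w al be n Hw Hal Hbe) as Hle.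
  assert (Hn : 0 < INR n) by (apply lt_0_INR, (H' false false)).
  assert (E : forall x y, pi x y * ((s x y - delta / 2) * INR n)
                <= pi x y * INR (count_wins V x y (al x) (be y))).
  { intros x y; apply Rmult_le_compat_l; [apply Hpi0|]; rewrite <- (Hal x); apply H'. }
  pose proof (E false false); pose proof (E false true);
  pose proof (E true false); pose proof (E true true).
  unfold sum_q in *.
  assert ((wstar - delta) * INR n <= w * INR n); [|nra].
  apply Rle_trans with ((pi false false * s false false + pi false true * s false true +
    pi true false * s true false + pi true true * s true true
    - delta / 2 * (pi false false + pi false true + pi true false + pi true true)) * INR n).
  - apply Rmult_le_compat_r; [lra|]; rewrite Hpi1; lra.
  - lra.
Qed.

(** Uniform questions give [pmin hardy_pi = 1/4], hence the constant [sqrt (1/4) / 2 = 1/4]. *)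
Lemma hardy_dim_bound (S : strategy (list bool) (list bool)) p eps :
  success hardy_pi hardy_V S p -> 0 < eps -> 1 - eps <= p ->
  1 / 4 / sqrt eps <= INR (Nat.min (dA S) (dB S)).
Proof.
  intros HS He Hp.
  assert (Epm : pmin hardy_pi = / 2 * / 2).
  { unfold pmin, hardy_pi; rewrite !Rmin_left by lra; lra. }
  replace (1 / 4) with (sqrt (pmin hardy_pi) / 2)
    by (rewrite Epm, sqrt_square by lra; lra).
  apply success_dim_bound with (V := hardy_V) (p := p); auto.
  - exact hardy_unwinnable.
  - split; [intros; unfold hardy_pi; lra|unfold sum_q, hardy_pi; lra].
  - rewrite Epm; lra.
Qed.

Theorem mainTheorem7 :
  (* (a) *)
  (forall eps, 0 < eps <= 1 ->
     forall (S : strategy (list bool) (list bool)) (p : R),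
       success hardy_pi hardy_V S p -> 1 - eps <= p ->
       1 / (16 * sqrt eps) <= INR (Nat.min (dA S) (dB S))) /\
  (forall (S : strategy (list bool) (list bool)) (p : R),
       success hardy_pi hardy_V S p -> p <> 1) /\
  (* (b) *)
  (exists c : R -> R, (forall pm, 0 < pm -> 0 < c pm) /\
     forall (OA OB : Type) (la : list OA) (lb : list OB),
       (forall a, In a la) -> (forall b, In b lb) ->
       forall (pi : bool -> bool -> R) (V : OA -> OB -> bool -> bool -> bool),
       is_distribution pi -> 0 < pmin pi ->
       forall w wstar : R,
       classical_value pi V w -> entangled_value pi V wstar -> w < wstar ->
       forall delta : R, 0 < delta < wstar - w ->
       forall (S0 : strategy OA OB) (s : bool -> bool -> R),
         valid_strategy S0 ->
         (forall x y, cond_success V S0 x y (s x y)) ->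
         wstar - delta / 2 <= sum_q (fun x y => pi x y * s x y) ->
       forall eps : R, 0 < eps ->
       forall (T : strategy (list OA) (list OB)) (p : R),
         success pi (inf_V V s delta) T p -> 1 - eps <= p ->
         c (pmin pi) / sqrt eps <= INR (Nat.min (dA T) (dB T))).
Proof.
  split; [|split].
  - intros eps [He _] S p HS Hp.
    assert (Hr : 0 < sqrt eps) by now apply sqrt_lt_R0.
    apply Rle_trans with (1 / 4 / sqrt eps); [|now apply hardy_dim_bound with p].
    replace (1 / (16 * sqrt eps)) with (1 / 16 / sqrt eps) by (field; lra).
    apply Rmult_le_compat_r; [left; now apply Rinv_0_lt_compat|lra].
  - intros S p HS ->.
    set (D := INR (Nat.min (dA S) (dB S))).
    assert (HD : 0 <= D) by apply pos_INR.
    (* A perfect strategy satisfies the bound for every error; the error [r * r] with this [r] would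
       give [2 * (D + 1) <= D]. *)
    set (r := / (8 * (D + 1))).
    assert (Hr : 0 < r) by (apply Rinv_0_lt_compat; lra).
    assert (H : 1 / 4 / sqrt (r * r) <= D) by (apply hardy_dim_bound with 1; auto; nra).
    rewrite sqrt_square in H by lra.
    replace (1 / 4 / r) with (2 * (D + 1)) in H by (unfold r; field; lra); lra.
  - exists (fun pm => sqrt pm / 2); split.
    { intros pm Hpm; apply Rdiv_lt_0_compat; [now apply sqrt_lt_R0|lra]. }
    (* The strategy [S0] enters only through its average success [Hs], which makes the repeated game
       unwinnable. *)
    intros OA OB la lb _ _ pi V Hpi Hpm w wstar Hw _ _ delta [_ Hd] S0 s _ _ Hs eps He T p HT Hp.
    apply success_dim_bound with (V := inf_V V s delta) (p := p); auto.
    now apply (inf_V_unwinnable pi V w wstar).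
Qed.
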